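(* Let $p,q\ge1$ be integers and $F=f+g+h$ on $E$, where $f$ is convex with $q$-th derivative Lipschitz with constant $L_{q,f}$, $g$ is convex with $p$-th derivative Lipschitz with constant $L_{p,g}$, and $h$ is a simple proper closed convex function. Let $x_*$ be a minimizer of $F$, and let $H_{q,f}\ge qL_{q,f}$ and $H_{p,g}\ge pL_{p,g}$. Let $(x_t)_{t\ge0}$ satisfy $x_{t+1}=T_{H_{q,f},H_{p,g}}(x_t)$, where $$T_{H_{q,f},H_{p,g}}(x)\in\operatorname{Argmin}_y\Big\{\Omega_q(f,x;y)+\frac{H_{q,f}}{(q+1)!}\|y-x\|^{q+1}+\Omega_p(g,x;y)+\frac{H_{p,g}}{(p+1)!}\|y-x\|^{p+1}+h(y)\Big\}.$$ Let $\alpha_0=1$ and $\alpha_t\in(0,1)$ for $t\ge1$. Then for every $t\ge0$ $$F(x_{t+1})-F(x_* )\le A_t\sum_{i=0}^t\left(C_f\frac{\alpha_i^{q+1}}{A_i}\|x_i-x_*\|^{q+1}+C_g\frac{\alpha_i^{p+1}}{A_i}\|x_i-x_*\|^{p+1}\right),$$ where $$C_f=\frac{H_{q,f}+L_{q,f}}{(q+1)!},\quad C_g=\frac{H_{p,g}+L_{p,g}}{(p+1)!},\quad A_0=1,\quad A_t=\prod_{i=1}^t(1-\alpha_i)\ \ (t\ge1).$$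
   Context: $E$ is a finite-dimensional real vector space with norm $\|\cdot\|$. The $m$-th derivative of $\phi$ is Lipschitz with constant $L$ if $\|D^m\phi(x)-D^m\phi(y)\|\le L\|x-y\|$ for all $x,y\in E$ (operator norm of multilinear forms). $\Omega_m(\phi,x;y)=\phi(x)+\sum_{k=1}^m\frac1{k!}D^k\phi(x)[y-x]^k$. Standing assumptions: $F$ has at least one minimizer $x_*$ and the level sets of $F$ are bounded. ''Simple'' means that the auxiliary minimization problem defining $T_{H_{q,f},H_{p,g}}$ is regarded as solvable. *)

(* Defs.v *)
From mathcomp Require Import all_boot all_order all_algebra.
From mathcomp Require Import all_classical all_reals all_analysis.
Import Order.TTheory GRing.Theory Num.Theory.
Import numFieldNormedType.Exports.

Set Implicit Arguments.
Unset Strict Implicit.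
Unset Printing Implicit Defensive.

Local Open Scope classical_set_scope.
Local Open Scope ring_scope.

Section Defs.
Context {R : realType}.

Definition finite_dimensional (E : lmodType R) : Prop :=
  exists (n : nat) (e : 'I_n -> E), forall x : E,
    exists c : 'I_n -> R, x = \sum_(i < n) c i *: e i.

Context {E : normedModType R}.
Implicit Types (phi : E -> R^o) (h : E -> \bar R).

(* D^k phi(x)[v_1, ..., v_k], with k = size vs, as an iterated directional
   derivative; the entry of vs nearest the end is differentiated first. *)
Definition Dn (vs : seq E) phi : E -> R^o := foldr (fun v psi => 'D_v psi) phi vs.

(* Since E is finite-dimensional, D^k phi is Frechet differentiable as a map
   into k-linear forms iff x |-> D^k phi(x)[vs] is for every vs of size k. *)
Definition times_differentiable (m : nat) phi : Prop :=
  forall vs : seq E, (size vs < m)%N -> forall x : E, differentiable (Dn vs phi) x.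

Definition form_norm (m : nat) (M : m.-tuple E -> R) : \bar R :=
  ereal_sup [set `|M v|%:E | v in [set v : m.-tuple E | forall i, `|tnth v i| <= 1]].

Definition lipschitz_derivative (m : nat) (L : R) phi : Prop :=
  times_differentiable m phi /\
  forall x y : E,
    (form_norm (fun v : m.-tuple E => ((Dn v phi x : R) - (Dn v phi y : R))%R)
       <= (L * `|x - y|)%:E)%E.

Definition taylor (m : nat) phi (x y : E) : R :=
  (phi x : R) + \sum_(1 <= k < m.+1) (k`!%:R)^-1 * (Dn (nseq k (y - x)) phi x : R).

Definition proper_fun h : Prop :=
  (forall x, h x != -oo%E) /\ (exists x, h x != +oo%E).

Definition epigraph h : set (E * R^o) := [set z | (h z.1 <= z.2%:E)%E].

Definition proper_closed_convex h : Prop :=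
  [/\ proper_fun h, closed (epigraph h) & convex_set (epigraph h)].

Definition Argmin (G : E -> \bar R) : set E :=
  [set y | forall z, (G y <= G z)%E].

Definition objective (f g : E -> R^o) h (x : E) : \bar R := (((f x : R) + (g x : R))%:E + h x)%E.

Definition model (p q : nat) (f g : E -> R^o) h (Hf Hg : R) (x y : E) : \bar R :=
  ((taylor q f x y + Hf / (q.+1)`!%:R * `|y - x| ^+ q.+1
    + taylor p g x y + Hg / (p.+1)`!%:R * `|y - x| ^+ p.+1)%:E + h y)%E.

End Defs.

Definition Aseq {R : realType} (alpha : nat -> R) (t : nat) : R :=
  \prod_(1 <= i < t.+1) (1 - alpha i).

(* Main.v *)
(** Integrating the Lipschitz bound on the last derivative along segments shows
    that a function differs from its Taylor model at [x] by at most
    [L / (m+1)! * |y - x|^(m+1)].  As [H >= m L >= L], the regularized model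
    majorizes [F], so [F (T x)] is at most the model at any [y], hence at most
    [F y + Cf |y - x|^(q+1) + Cg |y - x|^(p+1)].  Taking
    [y = alpha x* + (1 - alpha) x] and using convexity of [F] gives a
    contraction of [F - F x*] by [1 - alpha] up to these error terms, and
    unrolling the recursion yields the weights [A_t / A_i]. *)

Require Import Defs.
From mathcomp Require Import all_boot all_order all_algebra.
From mathcomp Require Import all_classical all_reals all_analysis.
From mathcomp Require Import lra ring.
Import Order.TTheory GRing.Theory Num.Theory.
Import numFieldNormedType.Exports.
Local Open Scope classical_set_scope.
Local Open Scope ring_scope.

Set Implicit Arguments.
Unset Strict Implicit.
Unset Printing Implicit Defensive.

(** * Taylor remainders of functions of one real variable *)

Lemma derive_ge0_le (R : realType) (r dr : R -> R) :
  (forall s : R, is_derive s 1 r (dr s)) -> (forall s : R, 0 <= s -> 0 <= dr s) ->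
  forall s : R, 0 <= s -> r 0 <= r s.
Proof.
move=> rD dr_ge0 s s_ge0.
apply: (@ger0_derive1_le_cc R r 0 s) => //.
- move=> z; rewrite in_itv /= => /andP[z0 _].
  by rewrite derive1E (@derive_val _ _ _ _ _ _ _ (rD z)) dr_ge0 // ltW.
- apply: continuous_subspaceT => z.
  by apply: differentiable_continuous; apply/derivable1_diffP; case: (rD z).
- by rewrite in_itv /= lexx.
- by rewrite in_itv /= s_ge0 lexx.
Qed.

Lemma is_derive_expn_fact (R : realType) (m : nat) (c s : R) :
  is_derive s 1 (fun s : R => c * (s ^+ m.+1 / m.+1`!%:R))
    (c * (s ^+ m / m`!%:R)).
Proof.
have mf_neq0 : m`!%:R != 0 :> R by rewrite pnatr_eq0 -lt0n fact_gt0.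
have -> : (fun s : R => c * (s ^+ m.+1 / m.+1`!%:R)) =
          (c / m.+1`!%:R) \*: ((@id R) ^+ m.+1).
  apply/funext => z; rewrite fctE /=.
  by rewrite [RHS]mulrAC mulrA.
apply: is_derive_eq.
rewrite factS natrM /GRing.scale /= mulr1 -mulr_natl.
by field; rewrite nat1r mf_neq0 pnatr_eq0.
Qed.

Lemma norm_le_of_norm_derive_le (R : realType) (m : nat) (K : R) (r dr : R -> R) :
  (forall s : R, is_derive s 1 r (dr s)) -> r 0 = 0 ->
  (forall s : R, 0 <= s -> `|dr s| <= K * (s ^+ m / m`!%:R)) ->
  forall s : R, 0 <= s -> `|r s| <= K * (s ^+ m.+1 / m.+1`!%:R).
Proof.
move=> rD r0 drK s s_ge0.
have KD := @is_derive_expn_fact R m K.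
rewrite ler_norml lerNl; apply/andP; split.
- rewrite -subr_ge0 opprK.
  have := @derive_ge0_le R (fun s => K * (s ^+ m.+1 / m.+1`!%:R) + r s) _
    (fun s => is_deriveD (KD s) (rD s)) _ s s_ge0.
  rewrite r0 expr0n /= mul0r mulr0 addr0; apply => z z0.
  by have := drK z z0; rewrite ler_norml lerNl => /andP[+ _]; lra.
- rewrite -subr_ge0.
  have := @derive_ge0_le R (fun s => K * (s ^+ m.+1 / m.+1`!%:R) - r s) _
    (fun s => is_deriveB (KD s) (rD s)) _ s s_ge0.
  rewrite r0 expr0n /= mul0r mulr0 subr0; apply => z z0.
  by have := drK z z0; rewrite ler_norml => /andP[_ +]; lra.
Qed.

(** [F k] stands for the [k]-th derivative of [F 0]. The remainder of [F 0] vanishes at 0, and its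
    derivative is the remainder, one order lower, of the shifted family [fun k => F k.+1]; induction
    then integrates once per order. *)
Lemma taylor_remainder_le (R : realType) (m : nat) (K : R) (F : nat -> R -> R) :
  (forall (k : nat) (s : R), (k < m)%N -> is_derive s 1 (F k) (F k.+1 s)) ->
  (forall s : R, 0 <= s -> `|F m s - F m 0| <= K * s) ->
  forall s : R, 0 <= s ->
    `|F 0%N s - \sum_(k < m.+1) F k 0 * (s ^+ k / k`!%:R)|
      <= K * (s ^+ m.+1 / m.+1`!%:R).
Proof.
elim: m F => [|m IHm] F FD FK.
  by move=> s s0; rewrite big_ord1 expr0 expr1 !divr1 mulr1 FK.
apply: norm_le_of_norm_derive_le (IHm (fun k => F k.+1) _ FK).
(* The term of index 0 is split off as a constant, so that differentiation lowers the exponent of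
   every other term by one. *)
- move=> s; rewrite [X in is_derive _ _ X](_ : _ = F 0%N -
    ((cst (F 0%N 0)) + \sum_(k < m.+1) (fun s => F k.+1 0 * (s ^+ k.+1 / k.+1`!%:R)))).
    apply: is_deriveB; first exact: FD.
    rewrite -[X in is_derive _ _ _ X]add0r; apply: is_deriveD.
    apply: is_derive_sum => k; exact: is_derive_expn_fact.
  apply/funext => z /=; rewrite big_ord_recl expr0 divr1 mulr1 /=.
  by rewrite !fctE; congr (_ - (_ + _)); rewrite fct_sumE.
- rewrite big_ord_recl big1 ?addr0 ?expr0 ?divr1 ?mulr1 ?subrr // => k _.
  by rewrite expr0n mul0r mulr0.
- by move=> k s km; apply: FD.
Qed.

(** * Taylor bounds on [E] by restriction to lines *)

(** The difference quotient of the restriction to the line at [s] is that of [psi] at [x + s *: v]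
    in direction [v], so no chain rule is called for. *)
Lemma is_derive_along (R : realType) (E : normedModType R) (psi : E -> R^o)
    (x v : E) (s : R) :
  differentiable psi (x + s *: v) ->
  is_derive s 1 (fun s : R => psi (x + s *: v) : R) ('D_v psi (x + s *: v)).
Proof.
move=> dpsi; have dv := @diff_derivable _ _ _ _ _ v dpsi : derivable psi (x + s *: v) v.
have eqf : (fun h : R => h^-1 *: (((fun s : R => psi (x + s *: v) : R^o) \o shift s) (h *: 1)
             - psi (x + s *: v)) : R^o) =
  (fun h : R => h^-1 *: ((psi \o shift (x + s *: v)) (h *: v) - psi (x + s *: v))).
  apply/funext => h /=; congr (_ *: (psi _ - _)).
  by rewrite [h *: 1]mulr1 scalerDl addrCA.
apply: DeriveDef; first by rewrite /derivable eqf.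
by rewrite /derive eqf.
Qed.

(** Each differentiation is linear in its direction and contributes one factor [c]. This homogeneity
    allows directions to be rescaled into the unit ball, where [form_norm] gives control. *)
Lemma DnZ (R : realType) (E : normedModType R) (phi : E -> R^o) (m : nat) :
  times_differentiable m phi -> forall (c : R) (v : E) (k : nat), (k <= m)%N ->
  Dn (nseq k (c *: v)) phi = (fun x => c ^+ k * (Dn (nseq k v) phi x : R)).
Proof.
move=> dphi c v; elim=> [_|k IHk km].
  by apply/funext => x; rewrite expr0 mul1r.
have dk x : differentiable (Dn (nseq k v) phi) x by apply: dphi; rewrite size_nseq.
have DS w : Dn (nseq k.+1 w) phi = 'D_w (Dn (nseq k w) phi) by [].
apply/funext => x; rewrite !DS IHk ?(ltnW km) //.
rewrite deriveE; last exact: (differentiableZ (c ^+ k) (dk x)).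
rewrite (@diffZ _ _ _ _ (c ^+ k) x (dk x)) linearZ /= -deriveE //.
by rewrite exprS -mulrA.
Qed.

Lemma Dn_lipschitz (R : realType) (E : normedModType R) (phi : E -> R^o)
    (m : nat) (L : R) :
  lipschitz_derivative m L phi -> forall x y v : E,
  `|(Dn (nseq m v) phi x : R) - (Dn (nseq m v) phi y : R)|
    <= L * `|x - y| * `|v| ^+ m.
Proof.
move=> [dphi Lphi] x y v.
(* The zero vector cannot be normalized. For [m = 0] the factor [0 ^+ 0] is 1 and the empty tuple
   gives the bound; for [m > 0] both sides are 0. *)
have [->|v0] := eqVneq v 0.
  case: m dphi Lphi => [|m] dphi Lphi.
    rewrite expr0 mulr1 -lee_fin; apply: le_trans (Lphi x y).
    by apply: ereal_sup_ubound; exists [tuple] => // -[].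
  have -> : 0 = 0 *: (0 : E) by rewrite scale0r.
  rewrite (DnZ dphi) // expr0n !mul0r subrr normr0.
  by rewrite scale0r normr0 expr0n mulr0.
have nv0 : `|v| != 0 by rewrite normr_eq0.
have -> : v = `|v| *: (`|v|^-1 *: v) by rewrite scalerA mulfV // scale1r.
set u := _^-1 *: v.
have u1 : `|u| = 1 by rewrite normrZ normfV normr_id mulVf.
rewrite (DnZ dphi) // -mulrBr normrM normrX normr_id.
rewrite normrZ u1 mulr1 normr_id mulrC ler_wpM2r ?exprn_ge0 //.
rewrite -lee_fin; apply: le_trans (Lphi x y).
apply: ereal_sup_ubound; exists [tuple of nseq m u] => // i.
by rewrite tnth_nseq u1.
Qed.

Lemma taylor_bound (R : realType) (E : normedModType R) (phi : E -> R^o)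
    (m : nat) (L : R) :
  lipschitz_derivative m L phi -> forall x y : E,
  `|(phi y : R) - taylor m phi x y| <= L / m.+1`!%:R * `|y - x| ^+ m.+1.
Proof.
move=> Lphi x y; have [dphi _] := Lphi.
set v := y - x.
have := @taylor_remainder_le R m (L * `|v| ^+ m.+1)
  (fun k s => Dn (nseq k v) phi (x + s *: v)) _ _ 1 ler01.
rewrite scale1r [x + v]addrC subrK => /= H.
apply: le_trans (_ : L * `|v| ^+ m.+1 * (1 ^+ m.+1 / m.+1`!%:R) <= _); last first.
  by rewrite expr1n mul1r mulrAC.
rewrite (_ : taylor m phi x y =
  \sum_(k < m.+1) (Dn (nseq k v) phi (x + 0 *: v) : R) * (1 ^+ k / k`!%:R)).
  apply: H => [k s km|s s0].
    by apply: is_derive_along; apply: dphi; rewrite size_nseq.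
  apply: le_trans (Dn_lipschitz Lphi _ _ v) _.
  rewrite scale0r addr0 addrC addKr normrZ ger0_norm // exprS.
  by rewrite le_eqVlt; apply/orP; left; apply/eqP; ring.
rewrite /taylor big_ord_recl /= scale0r addr0 expr0 divr1 mulr1.
congr (_ + _); rewrite big_add1 big_mkord; apply: eq_bigr => k _ /=.
by rewrite expr1n mul1r mulrC.
Qed.

(** * One step of the method *)

Section step.
Context {R : realType} {E : normedModType R}.
Implicit Types (f g phi : E -> R^o) (h : E -> \bar R).

Lemma le_taylor_add phi m L H (x y : E) :
  lipschitz_derivative m L phi -> (1 <= m)%N -> m%:R * L <= H ->
  phi y <= taylor m phi x y + H / m.+1`!%:R * `|y - x| ^+ m.+1 :> R.
Proof.
move=> Lphi m1 LH; have Tb := taylor_bound Lphi x y.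
(* The sign of [L] is unknown when [E] is trivial; only [L * w >= 0] is needed. *)
have := le_trans (normr_ge0 _) Tb; move: Tb; rewrite ![_ / _ * _]mulrAC -![_ * _ / _]mulrA.
set w := _ / _; move=> /ler_normlW Tb Lw0.
have w0 : 0 <= w by rewrite divr_ge0 ?exprn_ge0.
have Hw : m%:R * (L * w) <= H * w by rewrite mulrA ler_wpM2r.
have : L * w <= m%:R * (L * w) by rewrite ler_peMl // ler1n.
by lra.
Qed.

Lemma taylor_add_le phi m L H (x y : E) :
  lipschitz_derivative m L phi ->
  taylor m phi x y + H / m.+1`!%:R * `|y - x| ^+ m.+1
    <= (phi y : R) + (H + L) / m.+1`!%:R * `|y - x| ^+ m.+1.
Proof.
move=> Lphi; have := taylor_bound Lphi x y.
rewrite ler_norml lerNl => /andP[Tb _]; move: Tb.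
rewrite [(H + L) / _]mulrDl [(_ + _) * `|_| ^+ _]mulrDl.
by move: (_ * `|_| ^+ _) (_ * `|_| ^+ _) => *; lra.
Qed.

(** Three comparisons: the model majorizes the objective at [z], [z] minimizes the model, and at [y]
    the model exceeds the objective by at most the regularization ([Hf], [Hg]) plus the Taylor error
    ([Lf], [Lg]). *)
Lemma argmin_model_le p q f g h Lf Lg Hf Hg (x z y : E) :
  (1 <= p)%N -> (1 <= q)%N ->
  lipschitz_derivative q Lf f -> lipschitz_derivative p Lg g ->
  q%:R * Lf <= Hf -> p%:R * Lg <= Hg ->
  Argmin (model p q f g h Hf Hg x) z ->
  (objective f g h z <= objective f g h y
     + ((Hf + Lf) / (q.+1)`!%:R * `|y - x| ^+ q.+1
      + (Hg + Lg) / (p.+1)`!%:R * `|y - x| ^+ p.+1)%:E)%E.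
Proof.
move=> p1 q1 Lipf Lipg LHf LHg zmin.
apply: (@le_trans _ _ (model p q f g h Hf Hg x z)).
  rewrite leeD2r // lee_fin -addrA lerD //.
    exact: le_taylor_add LHf.
  exact: le_taylor_add LHg.
apply: le_trans (zmin y) _.
rewrite /objective addeAC -EFinD leeD2r // lee_fin -addrA [leRHS]addrACA lerD //.
  exact: taylor_add_le.
exact: taylor_add_le.
Qed.

Lemma convex_function_le f (s : R) (x y : E) :
  convex_function [set: convex_lmodType E] f -> 0 <= s -> s <= 1 ->
  f (s *: x + (1 - s) *: y) <= s * (f x : R) + (1 - s) * (f y : R).
Proof.
move=> fc s0 s1.
by have := fc (Itv01 s0 s1) x y (in_setT _) (in_setT _).
Qed.

Lemma convex_epigraph_le h (s a b : R) (x y : E) :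
  convex_set (epigraph h) -> 0 <= s -> s <= 1 ->
  h x = a%:E -> h y = b%:E ->
  (h (s *: x + (1 - s) *: y)%R <= (s * a + (1 - s) * b)%:E)%E.
Proof.
move=> hc s0 s1 hx hy.
have := hc (x, a) (y, b) (Itv01 s0 s1); rewrite !inE /epigraph /= hx hy.
by move=> /(_ (lexx _) (lexx _)).
Qed.

Lemma argmin_model_contract p q f g h Lf Lg Hf Hg (x z w : E) (s a b : R) :
  (1 <= p)%N -> (1 <= q)%N ->
  convex_function [set: convex_lmodType E] f ->
  convex_function [set: convex_lmodType E] g ->
  convex_set (epigraph h) ->
  lipschitz_derivative q Lf f -> lipschitz_derivative p Lg g ->
  q%:R * Lf <= Hf -> p%:R * Lg <= Hg ->
  Argmin (model p q f g h Hf Hg x) z ->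
  0 <= s -> s <= 1 -> objective f g h w = a%:E -> objective f g h x = b%:E ->
  (objective f g h z <= (s * a + (1 - s) * b
     + ((Hf + Lf) / (q.+1)`!%:R * (s ^+ q.+1 * `|x - w| ^+ q.+1)
      + (Hg + Lg) / (p.+1)`!%:R * (s ^+ p.+1 * `|x - w| ^+ p.+1)))%:E)%E.
Proof.
move=> p1 q1 fc gc hc Lipf Lipg LHf LHg zmin s0 s1 Fw Fx.
(* As [f] and [g] are real-valued, a finite objective makes [h] finite, and convexity can be applied
   to real numbers. *)
have hE u c : objective f g h u = c%:E -> h u = (c - (f u + g u))%:E.
  rewrite /objective; case: (h u) => // r [<-].
  by congr _%:E; rewrite addrAC subrr add0r.
apply: le_trans (argmin_model_le (s *: w + (1 - s) *: x) p1 q1 Lipf Lipg LHf LHg zmin) _.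
(* The trial point differs from [x] by [s *: (w - x)], whence the powers of [s] in the error
   terms. *)
have -> : `|s *: w + (1 - s) *: x - x| = s * `|x - w|.
  rewrite scalerBl scale1r addrCA addrAC subrr add0r -scalerBr normrZ distrC.
  by rewrite ger0_norm.
rewrite !exprMn [leRHS]EFinD leeD2r //.
have fs := convex_function_le w x fc s0 s1.
have gs := convex_function_le w x gc s0 s1.
have hs := convex_epigraph_le hc s0 s1 (hE _ _ Fw) (hE _ _ Fx).
apply: le_trans (leeD (_ : (_ <= (s * f w + (1 - s) * f x + (s * g w + (1 - s) * g x))%:E)%E) hs) _.
  by rewrite lee_fin lerD.
rewrite -EFinD lee_fin.
by rewrite le_eqVlt; apply/orP; left; apply/eqP; ring.
Qed.

End step.

(** * Accumulating the errors over the iterations *)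

Lemma AseqS (R : realType) (alpha : nat -> R) (t : nat) :
  Aseq alpha t.+1 = (1 - alpha t.+1) * Aseq alpha t.
Proof. by rewrite /Aseq big_nat_recr //= mulrC. Qed.

Lemma Aseq_gt0 (R : realType) (alpha : nat -> R) :
  (forall t, (1 <= t)%N -> alpha t < 1) -> forall t, 0 < Aseq alpha t.
Proof.
move=> alt1; elim=> [|t IHt]; first by rewrite /Aseq big_nil.
by rewrite AseqS mulr_gt0 // subr_gt0 alt1.
Qed.

Theorem theorem5 (R : realType) (E : normedModType R)
  (Efin : finite_dimensional E)
  (p q : nat) (p_ge1 : (1 <= p)%N) (q_ge1 : (1 <= q)%N)
  (f g : E -> R^o) (h : E -> \bar R) (Lf Lg Hf Hg : R)
  (f_convex : convex_function [set: convex_lmodType E] f)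
  (f_lip : lipschitz_derivative q Lf f)
  (g_convex : convex_function [set: convex_lmodType E] g)
  (g_lip : lipschitz_derivative p Lg g)
  (h_pcc : proper_closed_convex h)
  (level_bounded : forall c : R,
    bounded_set [set x : E | (objective f g h x <= c%:E)%E])
  (xstar : E) (xstar_min : Argmin (objective f g h) xstar)
  (Hf_ge : q%:R * Lf <= Hf) (Hg_ge : p%:R * Lg <= Hg)
  (T : E -> E) (T_argmin : forall x : E, Argmin (model p q f g h Hf Hg x) (T x))
  (x : nat -> E) (x_iter : forall t : nat, x t.+1 = T (x t))
  (alpha : nat -> R) (alpha0 : alpha 0%N = 1)
  (alpha_itv : forall t : nat, (1 <= t)%N -> 0 < alpha t < 1)
  (t : nat) :
  let Cf := (Hf + Lf) / (q.+1)`!%:R in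
  let Cg := (Hg + Lg) / (p.+1)`!%:R in
  let A := Aseq alpha in
  (objective f g h (x t.+1) - objective f g h xstar <=
   (A t * \sum_(0 <= i < t.+1)
      (Cf * (alpha i ^+ q.+1 / A i) * `|x i - xstar| ^+ q.+1 +
       Cg * (alpha i ^+ p.+1 / A i) * `|x i - xstar| ^+ p.+1))%:E)%E.
Proof.
cbv zeta; set Cf := (Hf + Lf) / _; set Cg := (Hg + Lg) / _; set A := Aseq alpha.
have [[hNy [x0 hx0]] _ hc] := h_pcc.
have obj_fin u c : (objective f g h u <= c%:E)%E ->
    exists d, objective f g h u = d%:E.
  rewrite /objective; move: (hNy u); case: (h u) => // r _ _.
  by exists (f u + g u + r).
have [fs Fs] : exists fs, objective f g h xstar = fs%:E.
  have := xstar_min x0; rewrite {2}/objective; move: (hNy x0) hx0.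
  by case: (h x0) => // r _ _; apply: obj_fin.
have A_gt0 : forall t, 0 < A t.
  by apply: Aseq_gt0 => i /alpha_itv /andP[].
(* In this form the induction hypothesis also yields, through [obj_fin], that the objective is
   finite at the current iterate. *)
suff : (objective f g h (x t.+1) <= (fs + A t * \sum_(0 <= i < t.+1)
      (Cf * (alpha i ^+ q.+1 / A i) * `|x i - xstar| ^+ q.+1 +
       Cg * (alpha i ^+ p.+1 / A i) * `|x i - xstar| ^+ p.+1))%:E)%E.
  by rewrite Fs leeBlDr // -EFinD addrC.
elim: t => [|t IHt].
  (* Since [alpha 0 = 1], the first trial point is [xstar] itself, so the objective at [x 0],
     possibly infinite, does not enter. *)
  apply: le_trans (argmin_model_le xstar p_ge1 q_ge1 f_lip g_lip Hf_ge Hg_ge _) _.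
    by rewrite x_iter; apply: T_argmin.
  rewrite Fs -EFinD lee_fin big_nat1 /A /Aseq big_nil alpha0 !expr1n divr1.
  by rewrite !mulr1 mul1r [`|xstar - _|]distrC.
have [b Fx] := obj_fin _ _ IHt.
have /andP[al0 al1] := alpha_itv t.+1 isT.
have := argmin_model_contract p_ge1 q_ge1 f_convex g_convex hc f_lip g_lip
  Hf_ge Hg_ge (T_argmin (x t.+1)) (ltW al0) (ltW al1) Fs Fx.
rewrite -x_iter => /le_trans; apply; rewrite lee_fin.
move: IHt; rewrite Fx lee_fin => IHt.
rewrite [in leRHS]big_nat_recr //=; set S := \sum_(0 <= i < _) _ in IHt *.
have := A_gt0 t.+1; rewrite /A AseqS -/A => At.
set a := alpha t.+1 in At *; set B := (1 - a) * A t in At *.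
rewrite mulrDr [B * (_ + _)]mulrDr.
(* [B] is the next weight [A t.+1]: it cancels the denominator of the newest summand, leaving the
   error of this step, while its factor [1 - a] on the older sum matches the contraction. *)
have BE c d e : B * (c * (d / B) * e) = c * (d * e).
  by field; rewrite gt_eqF.
rewrite !BE -/Cf -/Cg [leRHS]addrA lerD2r.
have : (1 - a) * b <= (1 - a) * (fs + A t * S) by rewrite ler_wpM2l // subr_ge0 ltW.
by rewrite /B; lra.
Qed.
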